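(* The Riemann solver $\mathcal{RS}_1$ does not, in general, satisfy the entropy inequality $\mathcal F(\mathcal{RS}_1(\rho_{1,0},\dots,\rho_{n+m,0}),\sigma)\ge0$ for every initial datum $(\rho_{1,0},\dots,\rho_{n+m,0})\in[0,1]^{n+m}$, and consequently does not satisfy the stronger requirement that $\mathcal F(\mathcal{RS}_1(\rho_{1,0},\dots,\rho_{n+m,0}),k)\ge0$ for every initial datum $(\rho_{1,0},\dots,\rho_{n+m,0})\in[0,1]^{n+m}$ and every $k\in[0,1]$. That is, there exist integers $n,m\ge1$, an admissible flux $f$ and a matrix $A\in\mathfrak N$ such that the corresponding Riemann solver $\mathcal{RS}_1$ at the node with $n$ incoming and $m$ outgoing arcs satisfies neither of these two requirements.
   Context: Admissible flux: $f:[0,1]\to\mathbb R$ continuous, piecewise smooth, concave, with $f(0)=f(1)=0$, and such that there is a unique $\sigma\in\,]0,1[$ with $f$ strictly increasing on $[0,\sigma[$ and strictly decreasing on $]\sigma,1]$. Convention: $\mathrm{sgn}(0)=0$. Incoming arcs have indices $1,\dots,n$, outgoing arcs $n+1,\dots,n+m$. Entropy conditions: let $\mathcal F(\rho_1,\dots,\rho_{n+m},k)=\sum_{i=1}^n\mathrm{sgn}(\rho_i-k)(f(\rho_i)-f(k))-\sum_{j=n+1}^{n+m}\mathrm{sgn}(\rho_j-k)(f(\rho_j)-f(k))$. A Riemann solver $\mathcal{RS}:[0,1]^{n+m}\to[0,1]^{n+m}$ satisfies (E1) if $\mathcal F(\mathcal{RS}(\rho_{1,0},\dots,\rho_{n+m,0}),k)\ge0$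 for every initial datum in $[0,1]^{n+m}$ and every $k\in[0,1]$; it satisfies (E2) if $\mathcal F(\mathcal{RS}(\rho_{1,0},\dots,\rho_{n+m,0}),\sigma)\ge0$ for every initial datum. Matrices: $\mathcal A$ is the set of real matrices $A=(a_{ji})$, $j=n+1,\dots,n+m$, $i=1,\dots,n$, with $0<a_{ji}<1$ for all $i,j$ and $\sum_{j=n+1}^{n+m}a_{ji}=1$ for all $i$. For $i\le n$ let $H_i=\{e_i\}^\perp\subset\mathbb R^n$ ($e_i$ the canonical basis) and for $j\ge n+1$ let $H_j=\{a_j\}^\perp$ with $a_j=(a_{j1},\dots,a_{jn})$. $\mathcal K$ is the set of ${\bf k}=(k_1,\dots,k_\ell)$ with $1\le\ell\le n-1$ and $1\le k_1<\dots<k_\ell\le n+m$; $H_{\bf k}=\bigcap_{h=1}^\ell H_{k_h}$; and $\mathfrak N=\{A\in\mathcal A:(1,\dots,1)\notin H_{\bf k}^\perp\text{ for every }{\bf k}\in\mathcal K\}$. Sets of fluxes for an initial datum $(\rho_{1,0},\dots,\rho_{n+m,0})$: for $i\le n$, $\Omega_i=[0,f(\rho_{i,0})]$ if $\rho_{i,0}\le\sigma$ and $\Omega_i=[0,f(\sigma)]$ if $\rho_{i,0}\ge\sigma$; for $j\ge n+1$, $\Omega_j=[0,f(\sigma)]$ if $\rho_{j,0}\le\sigma$ and $\Omega_j=[0,f(\rho_{j,0})]$ if $\rho_{j,0}\ge\sigma$. The solver $\mathcal{RS}_1$ (for fixed $A\in\mathfrak N$): let $\Omega=\{(\gamma_1,\dots,\gamma_n)\in\prod_{i=1}^n\Omega_i: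 A(\gamma_1,\dots,\gamma_n)^T\in\prod_{j=n+1}^{n+m}\Omega_j\}$; let $(\bar\gamma_1,\dots,\bar\gamma_n)$ be the point of $\Omega$ maximizing $\gamma_1+\dots+\gamma_n$ (unique because $A\in\mathfrak N$), and $(\bar\gamma_{n+1},\dots,\bar\gamma_{n+m})^T=A(\bar\gamma_1,\dots,\bar\gamma_n)^T$. For $i\le n$, $\bar\rho_i=\rho_{i,0}$ if $f(\rho_{i,0})=\bar\gamma_i$, otherwise $\bar\rho_i$ is the solution of $f(\rho)=\bar\gamma_i$ with $\rho\ge\sigma$; for $j\ge n+1$, $\bar\rho_j=\rho_{j,0}$ if $f(\rho_{j,0})=\bar\gamma_j$, otherwise $\bar\rho_j$ is the solution of $f(\rho)=\bar\gamma_j$ with $\rho\le\sigma$. Then $\mathcal{RS}_1(\rho_{1,0},\dots,\rho_{n+m,0})=(\bar\rho_1,\dots,\bar\rho_{n+m})$. *)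

(* Defs.v *)
From mathcomp Require Export all_boot all_order all_algebra.
From mathcomp Require Export all_classical all_reals all_analysis.
Import Order.TTheory GRing.Theory Num.Theory.
Import numFieldNormedType.Exports.

Set Implicit Arguments.
Unset Strict Implicit.
Unset Printing Implicit Defensive.

Local Open Scope classical_set_scope.
Local Open Scope ring_scope.

(* A flux f : [0, 1] -> R is a total function R -> R; every definition below
   only looks at its values on [0, 1]. *)

Definition smooth (R : realType) (g : R -> R) : Prop :=
  forall (k : nat) (x : R), derivable (derive1n k g) x 1.

(* f is C^oo up to the endpoints on each of the finitely many closed pieces
   [a_i, a_(i+1)], where a = a_0 < a_1 < ... < a_N = b is the list a :: s. *)
Definition piecewise_smooth (R : realType) (a b : R) (f : R -> R) : Prop :=
  exists s : seq R, itv_partition a b s /\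
    forall i : nat, (i < size s)%N ->
      exists g : R -> R, smooth g /\
        {in `[nth b (a :: s) i, nth b s i], f =1 g}.

Definition peak (R : realType) (f : R -> R) (sigma : R) : Prop :=
  [/\ 0 < sigma < 1,
      {in `[0, sigma[ &, {homo f : x y / x < y}} &
      {in `]sigma, 1] &, {homo f : x y /~ x < y}}].

Definition admissible_flux (R : realType) (f : R -> R) (sigma : R) : Prop :=
  [/\ {within `[0, 1], continuous f},
      piecewise_smooth 0 1 f,
      convex_function (`[0, 1]%classic : set R^o) (\- f),
      f 0 = 0 /\ f 1 = 0 &
      unique (peak f) sigma].

(* Incoming arcs are the indices lshift m i with i : 'I_n, outgoing arcs the
   indices rshift n j with j : 'I_m. *)

Definition cube (R : realType) (p : nat) : set 'cV[R]_p :=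
  [set rho | forall h, 0 <= rho h 0 <= 1].

Definition entropyF (R : realType) (n m : nat) (f : R -> R)
    (rho : 'cV[R]_(n + m)) (k : R) : R :=
  \sum_(i < n) Num.sg (rho (lshift m i) 0 - k) * (f (rho (lshift m i) 0) - f k)
  - \sum_(j < m) Num.sg (rho (rshift n j) 0 - k)
                 * (f (rho (rshift n j) 0) - f k).

Definition E1 (R : realType) (n m : nat) (f : R -> R)
    (RS : 'cV[R]_(n + m) -> 'cV[R]_(n + m)) : Prop :=
  forall rho0 : 'cV[R]_(n + m), cube rho0 ->
  forall k : R, 0 <= k <= 1 -> 0 <= entropyF f (RS rho0) k.

Definition E2 (R : realType) (n m : nat) (f : R -> R) (sigma : R)
    (RS : 'cV[R]_(n + m) -> 'cV[R]_(n + m)) : Prop :=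
  forall rho0 : 'cV[R]_(n + m), cube rho0 -> 0 <= entropyF f (RS rho0) sigma.

(* Row j of A : 'M_(m, n) belongs to the outgoing arc rshift n j. *)
Definition calA (R : realType) (n m : nat) : set 'M[R]_(m, n) :=
  [set A : 'M[R]_(m, n) |
    (forall j i, 0 < A j i < 1) /\ (forall i, \sum_j A j i = 1)].

Definition perp (R : realType) (n : nat) (S : set 'cV[R]_n) : set 'cV[R]_n :=
  [set v | forall w, S w -> \sum_(i < n) v i 0 * w i 0 = 0].

Definition Hplane (R : realType) (n m : nat) (A : 'M[R]_(m, n))
    (h : 'I_(n + m)) : set 'cV[R]_n :=
  match fintype.split h with
  | inl i => perp [set delta_mx i 0]
  | inr j => perp [set (row j A)^T]
  end.

Definition calK (n m : nat) : set (seq 'I_(n + m)) :=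
  [set k | (1 <= size k <= n - 1)%N /\
           sorted (fun h h' : 'I_(n + m) => (h < h')%N) k].

Definition frakN (R : realType) (n m : nat) : set 'M[R]_(m, n) :=
  [set A : 'M[R]_(m, n) | calA A /\
    forall k : seq 'I_(n + m), calK k ->
      ~ perp (\bigcap_(h in [set` k]) Hplane A h) (const_mx 1)].

Definition Omega_in (R : realType) (f : R -> R) (sigma r : R) : set R :=
  [set` if r <= sigma then `[0, f r] else `[0, f sigma]].

Definition Omega_out (R : realType) (f : R -> R) (sigma r : R) : set R :=
  [set` if r <= sigma then `[0, f sigma] else `[0, f r]].

Definition Omega (R : realType) (n m : nat) (f : R -> R) (sigma : R)
    (A : 'M[R]_(m, n)) (rho0 : 'cV[R]_(n + m)) : set 'cV[R]_n :=
  [set g : 'cV[R]_n |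
           (forall i, Omega_in f sigma (rho0 (lshift m i) 0) (g i 0)) /\
           (forall j, Omega_out f sigma (rho0 (rshift n j) 0) ((A *m g) j 0))].

Definition flux_maximizer (R : realType) (n m : nat) (f : R -> R) (sigma : R)
    (A : 'M[R]_(m, n)) (rho0 : 'cV[R]_(n + m)) (g : 'cV[R]_n) : Prop :=
  Omega f sigma A rho0 g /\
  forall g', Omega f sigma A rho0 g' -> \sum_i g' i 0 <= \sum_i g i 0.

Definition trace_in (R : realType) (f : R -> R) (sigma r0 g r : R) : Prop :=
  if f r0 == g then r = r0
  else unique (fun x => [/\ 0 <= x <= 1, sigma <= x & f x = g]) r.

Definition trace_out (R : realType) (f : R -> R) (sigma r0 g r : R) : Prop :=
  if f r0 == g then r = r0
  else unique (fun x => [/\ 0 <= x <= 1, x <= sigma & f x = g]) r.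

(* RS is the solver RS_1 of A. On the cube this determines RS, because each
   definite description in the construction is rendered by [unique]; values of
   RS outside the cube are irrelevant. *)
Definition is_RS1 (R : realType) (n m : nat) (f : R -> R) (sigma : R)
    (A : 'M[R]_(m, n)) (RS : 'cV[R]_(n + m) -> 'cV[R]_(n + m)) : Prop :=
  forall rho0 : 'cV[R]_(n + m), cube rho0 ->
  exists g : 'cV[R]_n,
    [/\ unique (flux_maximizer f sigma A rho0) g,
        forall i, trace_in f sigma (rho0 (lshift m i) 0) (g i 0)
                    (RS rho0 (lshift m i) 0) &
        forall j, trace_out f sigma (rho0 (rshift n j) 0) ((A *m g) j 0)
                    (RS rho0 (rshift n j) 0)].

(* Main.v *)
Require Import Defs.
From mathcomp Require Import ring lra.
Import Order.TTheory GRing.Theory Num.Theory.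
Import numFieldNormedType.Exports.
Set Implicit Arguments.
Unset Strict Implicit.
Unset Printing Implicit Defensive.

Local Open Scope classical_set_scope.
Local Open Scope ring_scope.

(** One incoming and two outgoing arcs already suffice, with traffic split
    evenly.  Take the tent flux, whose maximum 1/2 is attained at 1/2, and the
    datum (1, 1, 0): the incoming road and the first outgoing road are full,
    the second outgoing road is empty.  The full outgoing road accepts nothing,
    and because a fixed positive fraction of the drivers insists on entering
    it, nothing crosses the node at all.  All three densities then already
    carry the prescribed flux 0, so the solver leaves the datum unchanged
    ([RS1_jam]).  At [k = 1/2] each arc contributes the full amount 1/2 in
    absolute value: the congested incoming arc contributes -1/2, the congested
    outgoing arc +1/2 and the free outgoing arc -1/2.  The sum is -1/2 < 0,
    so (E2) fails, and (E1) fails with it.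

    Since [is_RS1] constrains the solver on the whole cube, the solver must
    also be shown to exist.  With a single incoming arc the feasible set
    [Omega] is a segment [0, throughput], whose right end is the unique
    maximizer, and each monotone branch of the tent is inverted by an affine
    map; this makes the solver explicit ([is_RS1_solver]). *)

(** * The tent flux *)

Lemma smooth_horner (R : realType) (p : {poly R}) : smooth (horner p).
Proof.
move=> k x; suff -> : derive1n k (horner p) = horner p^`(k).
  exact: derivable_horner.
elim: k => [|k IHk]; first by rewrite derivn0.
by rewrite derive1nS IHk derivnS derivE.
Qed.

Section Tent.
Variable R : realType.
Implicit Types x y r s g : R.

Definition tent x : R := Num.min x (1 - x).

Lemma tent_left x : x <= 2^-1 -> tent x = x.
Proof. by move=> hx; apply/min_idPl; lra. Qed.

Lemma tent_right x : 2^-1 <= x -> tent x = 1 - x.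
Proof. by move=> hx; apply/min_idPr; lra. Qed.

Lemma tent_itv x : 0 <= x <= 1 -> 0 <= tent x <= 2^-1.
Proof.
by move=> x01; case: (leP x 2^-1) => hx; [rewrite tent_left | rewrite tent_right]; lra.
Qed.

Lemma continuous_tent : continuous tent.
Proof.
move=> x; apply: (@continuous_min R R id (fun y => 1 - y) x).
  exact: cvg_id.
by apply: cvgB; [exact: cvg_cst | exact: cvg_id].
Qed.

Lemma piecewise_smooth_tent : piecewise_smooth 0 1 tent.
Proof.
exists [:: 2^-1; 1]; split.
  by split => //=; rewrite andbT; apply/andP; split; lra.
case=> [_|[_|//]] /=.
  exists (horner 'X); split; first exact: smooth_horner.
  by move=> x; rewrite in_itv /= => hx; rewrite hornerE tent_left; lra.
exists (horner (1 - 'X)); split; first exact: smooth_horner.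
by move=> x; rewrite in_itv /= => hx; rewrite !hornerE tent_right; lra.
Qed.

(** A minimum of two affine functions is concave: each branch bounds the tent
    from above, hence dominates the convex combination of its values. *)
Lemma tent_concave u x y : 0 <= u <= 1 ->
  u * tent x + (1 - u) * tent y <= tent (u * x + (1 - u) * y).
Proof.
move=> /andP[u0 u1]; have {}u1 : 0 <= 1 - u by rewrite subr_ge0.
have tl z : tent z <= z by rewrite ge_min lexx.
have tr z : tent z <= 1 - z by rewrite ge_min lexx orbT.
rewrite [leRHS]/tent le_min; apply/andP; split.
  by apply: lerD; exact: ler_wpM2l.
have -> : 1 - (u * x + (1 - u) * y) = u * (1 - x) + (1 - u) * (1 - y) by ring.
by apply: lerD; exact: ler_wpM2l.
Qed.

Lemma convex_opp_tent :
  convex_function (`[0, 1]%classic : set R^o) (\- tent).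
Proof.
move=> t x y _ _; rewrite !convRE /unstable.onem /=.
rewrite !mulrN -opprD lerN2; apply: tent_concave.
by apply/andP; split.
Qed.

(** Uniqueness of the peak: two peaks would leave an interval between them on
    which the flux is both strictly increasing and strictly decreasing. *)
Lemma peak_unique (f : R -> R) r s : peak f r -> peak f s -> r = s.
Proof.
wlog rs : r s / r < s.
  by move=> W pr ps; case: (ltgtP r s) => // h; [exact: W|apply/esym/W].
move=> [/andP[r0 r1] _ dec] [/andP[s0 s1] inc _]; exfalso.
have h1 : f ((2 * r + s) / 3) < f ((r + 2 * s) / 3).
  by apply: inc; rewrite ?in_itv /=; lra.
have h2 : f ((r + 2 * s) / 3) < f ((2 * r + s) / 3).
  by apply: dec; rewrite ?in_itv /=; lra.
lra.
Qed.

Lemma peak_tent : peak tent 2^-1.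
Proof.
split; first by apply/andP; split; lra.
- move=> x y; rewrite !in_itv /= => hx hy xy.
  by rewrite !tent_left; lra.
- move=> x y; rewrite !in_itv /= => hx hy xy.
  by rewrite !tent_right; lra.
Qed.

Lemma admissible_tent : admissible_flux tent 2^-1.
Proof.
split.
- exact/continuous_subspaceT/continuous_tent.
- exact: piecewise_smooth_tent.
- exact: convex_opp_tent.
- by rewrite tent_left ?tent_right; lra.
- by split=> [|s]; [exact: peak_tent | apply: peak_unique; exact: peak_tent].
Qed.

(** * The solver on one incoming and two outgoing arcs *)

Definition cap_in r : R := if r <= 2^-1 then tent r else 2^-1.
Definition cap_out r : R := if r <= 2^-1 then 2^-1 else tent r.

Lemma Omega_in_tent r g : Omega_in tent 2^-1 r g = (0 <= g <= cap_in r).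
Proof.
rewrite /Omega_in /cap_in /= (@tent_left 2^-1) //.
by case: ifP => _; rewrite /= in_itv.
Qed.

Lemma Omega_out_tent r g : Omega_out tent 2^-1 r g = (0 <= g <= cap_out r).
Proof.
rewrite /Omega_out /cap_out /= (@tent_left 2^-1) //.
by case: ifP => _; rewrite /= in_itv.
Qed.

Lemma cap_in_itv r : 0 <= r <= 1 -> 0 <= cap_in r <= 2^-1.
Proof. by move=> /tent_itv; rewrite /cap_in; case: ifP => _; lra. Qed.

Lemma cap_out_itv r : 0 <= r <= 1 -> 0 <= cap_out r <= 2^-1.
Proof. by move=> /tent_itv; rewrite /cap_out; case: ifP => _; lra. Qed.

Definition right_trace r g : R := if tent r == g then r else 1 - g.
Definition left_trace r g : R := if tent r == g then r else g.

Lemma trace_in_tent r g :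
  0 <= g <= 2^-1 -> trace_in tent 2^-1 r g (right_trace r g).
Proof.
rewrite /trace_in /right_trace => g01; case: (tent r == g) => //.
split; first by rewrite tent_right; [split; lra | lra].
by move=> x [x01 hx]; rewrite tent_right // => <-; ring.
Qed.

Lemma trace_out_tent r g :
  0 <= g <= 2^-1 -> trace_out tent 2^-1 r g (left_trace r g).
Proof.
rewrite /trace_out /left_trace => g01; case: (tent r == g) => //.
split; first by rewrite tent_left; [split; lra | lra].
by move=> x [x01 hx]; rewrite tent_left // => <-.
Qed.

Definition even_split : 'M[R]_(2, 1) := const_mx 2^-1.

Lemma even_splitE (g : 'cV[R]_1) j : (even_split *m g) j 0 = g 0 0 / 2.
Proof. by rewrite mxE big_ord1 mxE mulrC. Qed.

(** With [n = 1] no index tuple has length between 1 and [n - 1 = 0], so [calK]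
    is empty and the non-degeneracy condition is void. *)
Lemma frakN_even_split : frakN even_split.
Proof.
split; first split.
- by move=> j i; rewrite mxE; apply/andP; split; lra.
- by move=> i; rewrite big_ord_recl big_ord1 !mxE; lra.
- by move=> k [] /andP[k1 k0]; have := leq_trans k1 k0.
Qed.

Implicit Types rho : 'cV[R]_(1 + 2).

Definition rho_in rho : R := rho (lshift 2 0) 0.
Definition rho_out rho (j : 'I_2) : R := rho (rshift 1 j) 0.

(** Half of the incoming flux enters each outgoing arc, so an outgoing
    capacity limits the incoming flux to twice its value. *)
Definition throughput rho : R :=
  Num.min (cap_in (rho_in rho))
    (2 * Num.min (cap_out (rho_out rho 0)) (cap_out (rho_out rho 1))).

Lemma Omega_even_split rho (g : 'cV[R]_1) :
  Omega tent 2^-1 even_split rho g <-> 0 <= g 0 0 <= throughput rho.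
Proof.
have tE : (0 <= g 0 0 <= throughput rho) =
    [&& 0 <= g 0 0 <= cap_in (rho_in rho),
        0 <= g 0 0 / 2 <= cap_out (rho_out rho 0) &
        0 <= g 0 0 / 2 <= cap_out (rho_out rho 1)].
  rewrite /throughput le_min mulrC -ler_pdivrMr // le_min pmulr_lge0 //.
  by case: (0 <= g 0 0); rewrite ?andbF.
rewrite tE; split=> [[gin gout]|/and3P[gin g0 g1]].
  have := gin 0; have := gout 0; have := gout 1.
  by rewrite !Omega_out_tent Omega_in_tent !even_splitE => -> -> ->.
split=> [i|j]; first by rewrite ord1 Omega_in_tent.
rewrite Omega_out_tent even_splitE.
case: (unliftP 0 j) => [i|] -> //.
by rewrite (_ : lift 0 i = 1) //; apply/val_inj; rewrite /= ord1.
Qed.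

Lemma throughput_itv rho : cube rho -> 0 <= throughput rho <= 2^-1.
Proof.
move=> c; rewrite /throughput.
have /andP[hi hs] := cap_in_itv (c (lshift 2 0)).
have /andP[h0 _] := cap_out_itv (c (rshift 1 0)).
have /andP[h1 _] := cap_out_itv (c (rshift 1 1)).
by rewrite le_min ge_min hi hs mulr_ge0 // le_min h0 h1.
Qed.

Lemma throughput_maximizer rho : cube rho ->
  unique (flux_maximizer tent 2^-1 even_split rho) (const_mx (throughput rho)).
Proof.
move=> /throughput_itv /andP[t0 _]; split.
  split; first by apply/Omega_even_split; rewrite mxE t0 lexx.
  by move=> g /Omega_even_split /andP[_]; rewrite !big_ord1 mxE.
move=> g [/Omega_even_split /andP[_ gt]].
move=> /(_ (const_mx (throughput rho))); rewrite !big_ord1 mxE => tg.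
apply/matrixP => i j; rewrite !ord1 mxE; apply/le_anti.
rewrite gt andbT; apply: tg; apply/Omega_even_split.
by rewrite mxE t0 lexx.
Qed.

Definition solver rho : 'cV[R]_(1 + 2) :=
  col_mx (\col_i right_trace (rho_in rho) (throughput rho))
         (\col_j left_trace (rho_out rho j) (throughput rho / 2)).

Lemma is_RS1_solver : is_RS1 tent 2^-1 even_split solver.
Proof.
move=> rho c; have t01 := throughput_itv c.
exists (const_mx (throughput rho)); split.
- exact: throughput_maximizer.
- by move=> i; rewrite ord1 col_mxEu !mxE; apply: trace_in_tent.
- move=> j; rewrite even_splitE col_mxEd !mxE; apply: trace_out_tent.
  by lra.
Qed.

(** * The jammed node *)

Definition jam : 'cV[R]_(1 + 2) :=
  col_mx (const_mx 1) (\col_j (if j == 0 then 1 else 0)).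

Lemma cube_jam : cube jam.
Proof.
move=> h; rewrite -[h]splitK; case: (fintype.split h) => j /=.
  by rewrite col_mxEu mxE ler01 lexx.
by rewrite col_mxEd mxE; case: ifP; rewrite ?ler01 ?lexx.
Qed.

(** The full first outgoing arc has capacity 0, which forces the flux through
    the node to be 0, and all densities of [jam] carry that flux already. *)
Lemma RS1_jam (RS : 'cV[R]_(1 + 2) -> 'cV[R]_(1 + 2)) :
  is_RS1 tent 2^-1 even_split RS -> RS jam = jam.
Proof.
move=> /(_ _ cube_jam) [g [[[[_ gout] _] _] tin tout]].
have g0 : g 0 0 = 0.
  have := gout 0; rewrite Omega_out_tent even_splitE col_mxEd mxE /cap_out.
  by rewrite eqxx ifF ?tent_right; lra.
apply/matrixP => h k; rewrite (ord1 k) -[h]splitK.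
case: (fintype.split h) => i /=; rewrite ?ord1.
  have := tin 0; rewrite /trace_in g0 [tent _](_ : _ = 0) ?eqxx //.
  by rewrite col_mxEu mxE tent_right; lra.
have := tout i; rewrite /trace_out even_splitE g0 mul0r [tent _](_ : _ = 0) ?eqxx //.
by rewrite col_mxEd mxE; case: ifP => _; [rewrite tent_right|rewrite tent_left]; lra.
Qed.

Lemma entropyF_jam : entropyF tent jam 2^-1 = - 2^-1.
Proof.
rewrite /entropyF big_ord1 big_ord_recl big_ord1 !col_mxEu !col_mxEd !mxE /=.
rewrite [tent 2^-1]tent_left // [tent 1]tent_right ?[tent 0]tent_left; [|lra..].
rewrite gtr0_sg ?ltr0_sg; lra.
Qed.

Lemma RS1_not_E2 (RS : 'cV[R]_(1 + 2) -> 'cV[R]_(1 + 2)) :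
  is_RS1 tent 2^-1 even_split RS -> ~ E2 tent 2^-1 RS.
Proof.
by move=> hRS /(_ _ cube_jam); rewrite (RS1_jam hRS) entropyF_jam; lra.
Qed.

End Tent.

Lemma E1_E2 (R : realType) (n m : nat) (f : R -> R) (sigma : R)
    (RS : 'cV[R]_(n + m) -> 'cV[R]_(n + m)) :
  0 <= sigma <= 1 -> E1 f RS -> E2 f sigma RS.
Proof. by move=> s01 h rho c; apply: h. Qed.

Theorem proposition5p1 (R : realType) :
  exists (n m : nat) (f : R -> R) (sigma : R) (A : 'M[R]_(m, n))
         (RS : 'cV[R]_(n + m) -> 'cV[R]_(n + m)),
    [/\ (1 <= n)%N /\ (1 <= m)%N,
        admissible_flux f sigma,
        frakN A,
        is_RS1 f sigma A RS &
        ~ E2 f sigma RS /\ ~ E1 f RS].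
Proof.
exists 1%N, 2%N, (@tent R), 2^-1, (even_split R), (@solver R).
have hRS := @is_RS1_solver R.
split => //; [exact: admissible_tent|exact: frakN_even_split|].
split; first exact: RS1_not_E2.
move=> /E1_E2 h; apply: (RS1_not_E2 hRS); apply: h.
by apply/andP; split; lra.
Qed.
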